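(* Let $\Omega=\{1,2,3,4\}$. Up to isomorphism there is exactly one association scheme on triples (AST) of order $5$ on $\Omega$ (i.e. with exactly two nontrivial relations). Its nontrivial relations are \begin{align*} R_4=\{&(1,2,3),(1,3,4),(1,4,2),(2,1,4),(2,3,1),(2,4,3),\\ &(3,1,2),(3,2,4),(3,4,1),(4,1,3),(4,2,1),(4,3,2)\},\\ R_5=\{&(1,2,4),(1,3,2),(1,4,3),(2,1,3),(2,3,4),(2,4,1),\\ &(3,1,4),(3,2,1),(3,4,2),(4,1,2),(4,2,3),(4,3,1)\}. \end{align*} Moreover, after identifying the underlying four-element sets by a bijection, this AST is the AST induced by the action of $PSL(2,3)$ on the projective line $PG(1,3)$, and it is isomorphic to the AST induced by the action of $AGL(1,4)$ on the Galois field $GF(4)$.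
   Context: Let $\Omega$ be a finite set with $|\Omega|=n\geq 3$. An association scheme on triples (AST) of order $m\geq 4$ on $\Omega$ is a partition $X=\{R_i\}_{i=0}^m$ of $\Omega\times\Omega\times\Omega$ (into $m+1$ nonempty parts) such that: (1) For each $i\in\{0,\ldots,m\}$ there is a constant $n_i^{(3)}\in\mathbb{N}\cup\{0\}$ such that $|\{z\in\Omega : (x,y,z)\in R_i\}|=n_i^{(3)}$ for any pair of distinct $x,y\in\Omega$. (2) For any $i,j,k,l\in\{0,\ldots,m\}$ there is a constant $p_{ijk}^l\in\mathbb{N}\cup\{0\}$ such that $|\{w\in\Omega : (w,y,z)\in R_i,\ (x,w,z)\in R_j,\ (x,y,w)\in R_k\}|=p_{ijk}^l$ for every $(x,y,z)\in R_l$. (3) For any $i\in\{0,\ldots,m\}$ and $\sigma\in S_3$ there is $j\in\{0,\ldots,m\}$ such that $R_i^\sigma:=\{(x_{\sigma(1)},x_{\sigma(2)},x_{\sigma(3)}) : (x_1,x_2,x_3)\in R_i\}=R_j$. (4) The first four relations are the trivial relations $R_0=\{(x,x,x):x\in\Omega\}$, $R_1=\{(y,x,x):x,y\in\Omega,\ x\neq y\}$, $R_2=\{(x,y,x):x,y\in\Omega,\ x\neq y\}$, $R_3=\{(x,x,y):x,y\in\Omega,\ x\neq y\}$. The relations $R_4,\ldots,R_m$ are called the nontrivial relations. For $R\subseteq\Omega\times\Omega\times\Omega$ and $\sigma\in S_\Omega$, put $\sigma(R)=\{(\sigma(x),\sigma(y),\sigma(z)):(x,y,z)\in R\}$. Two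 ASTs $\{R_i\}_{i=0}^m$ and $\{S_i\}_{i=0}^m$ of order $m$ on $\Omega$ are isomorphic if there is $\sigma\in S_\Omega$ with $\{\sigma(R_i)\}_{i=0}^m=\{S_i\}_{i=0}^m$ as unordered sets. The AST induced by a two-transitive group $H$ acting on a set $\Omega$ with at least $4$ elements is the partition of $\Omega\times\Omega\times\Omega$ into the orbits of the natural (diagonal) action of $H$. Here $AGL(1,q)$ is the group of maps $x\mapsto ax+b$ of $GF(q)$ with $a\neq 0$. *)

(* Defs.v *)
From HB Require Import structures.
From mathcomp Require Import all_boot all_order all_algebra.
From mathcomp Require Import all_fingroup all_solvable all_field.

Set Implicit Arguments.
Unset Strict Implicit.
Unset Printing Implicit Defensive.

Import GroupScope GRing.Theory FinRing.Theory.
Local Open Scope ring_scope.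

(* Omega x Omega x Omega is represented by 3.-tuple Omega. *)

Section AssociationSchemes.

Variable T : finType.
Implicit Type R : {set 3.-tuple T}.

Definition permute_rel (s : 'S_3) R : {set 3.-tuple T} :=
  [set [tuple tnth t (s i) | i < 3] | t in R].

Definition triv0 : {set 3.-tuple T} := [set [tuple x; x; x] | x : T].
Definition triv1 : {set 3.-tuple T} :=
  [set [tuple y; x; x] | x : T, y : T in [set~ x]].
Definition triv2 : {set 3.-tuple T} :=
  [set [tuple x; y; x] | x : T, y : T in [set~ x]].
Definition triv3 : {set 3.-tuple T} :=
  [set [tuple x; x; y] | x : T, y : T in [set~ x]].

(* Association scheme on triples of order m, as an indexed family of relations.
   ast_partition and ast_inj together say that R_0, ..., R_m are m + 1
   nonempty, pairwise disjoint sets covering all the triples. *)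
Record is_ast (m : nat) (R : 'I_m.+1 -> {set 3.-tuple T}) : Prop := IsAst {
  ast_card : (3 <= #|T|)%N;
  ast_order : (4 <= m)%N;
  ast_partition : partition [set R i | i : 'I_m.+1] [set: 3.-tuple T];
  ast_inj : injective R;
  ast_third_valency : forall i, exists n : nat, forall x y, x != y ->
    #|[set z | [tuple x; y; z] \in R i]| = n;
  ast_intersection : forall i j k l, exists p : nat, forall x y z,
    [tuple x; y; z] \in R l ->
    #|[set w | [&& [tuple w; y; z] \in R i, [tuple x; w; z] \in R j
                 & [tuple x; y; w] \in R k]]| = p;
  ast_symmetric : forall i (s : 'S_3), exists j, permute_rel s (R i) = R j;
  ast_triv0 : R (inord 0) = triv0;
  ast_triv1 : R (inord 1) = triv1;
  ast_triv2 : R (inord 2) = triv2;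
  ast_triv3 : R (inord 3) = triv3
}.

(* Partition of the triples into the orbits of the diagonal action of a
   permutation group H. *)
Definition triple_orbits (H : {group {perm T}}) : {set {set 3.-tuple T}} :=
  orbit ('P * 3)%act H @: [set: 3.-tuple T].

(* R is an indexing of the AST induced by the two-transitive group H. *)
Definition induced_ast (m : nat) (H : {group {perm T}})
    (R : 'I_m.+1 -> {set 3.-tuple T}) : Prop :=
  [/\ (4 <= #|T|)%N, [transitive^2 H, on [set: T] | 'P], is_ast R
    & [set R i | i : 'I_m.+1] = triple_orbits H].

End AssociationSchemes.

Definition image_rel (T T' : finType) (f : T -> T') (R : {set 3.-tuple T}) :
    {set 3.-tuple T'} :=
  [set map_tuple f t | t in R].

(* For T' = T the bijection f ranges over the symmetric group of T; allowing
   T' <> T covers the identification of distinct underlying sets. *)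
Definition ast_isomorphic (T T' : finType) (m : nat)
    (R : 'I_m.+1 -> {set 3.-tuple T}) (R' : 'I_m.+1 -> {set 3.-tuple T'}) :
    Prop :=
  exists2 f : T -> T', bijective f
    & [set image_rel f (R i) | i : 'I_m.+1] = [set R' i | i : 'I_m.+1].

(* The set {1, 2, 3, 4} is represented by 'I_4, the point a being the ordinal
   a - 1. *)
Definition triple4 (a b c : nat) : 3.-tuple 'I_4 :=
  [tuple inord a.-1; inord b.-1; inord c.-1].

Definition rel4 : {set 3.-tuple 'I_4} := [set t in
  [:: triple4 1 2 3; triple4 1 3 4; triple4 1 4 2;
      triple4 2 1 4; triple4 2 3 1; triple4 2 4 3;
      triple4 3 1 2; triple4 3 2 4; triple4 3 4 1;
      triple4 4 1 3; triple4 4 2 1; triple4 4 3 2]].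

Definition rel5 : {set 3.-tuple 'I_4} := [set t in
  [:: triple4 1 2 4; triple4 1 3 2; triple4 1 4 3;
      triple4 2 1 3; triple4 2 3 4; triple4 2 4 1;
      triple4 3 1 4; triple4 3 2 1; triple4 3 4 2;
      triple4 4 1 2; triple4 4 2 3; triple4 4 3 1]].

Section Groups.

Variable F : finFieldType.

(* Points of PG(1,F): the one-dimensional subspaces of F^2, as sets of row
   vectors. *)
Definition is_line (L : {set 'rV[F]_2}) : bool :=
  [exists v : 'rV[F]_2, (v != 0) && (L == [set a *: v | a : F])].

Definition PG1 : finType := {L : {set 'rV[F]_2} | is_line L}.

Definition line_image (L : {set 'rV[F]_2}) (A : {'GL_2[F]}) :
    {set 'rV[F]_2} :=
  [set v *m GLval A | v in L].

Lemma line_imageP (L : PG1) (A : {'GL_2[F]}) : is_line (line_image (val L) A).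
Proof.
case: L => L /= /existsP[v /andP[v0 /eqP->]]; apply/existsP.
exists (v *m GLval A); apply/andP; split.
  apply: contraNneq v0 => vA0.
  by rewrite -(mulmxK (GL_unitmx A) v) vA0 mul0mx.
apply/eqP/setP=> w; apply/imsetP/imsetP.
  by case=> _ /imsetP[a _ ->] ->; exists a; rewrite // scalemxAl.
case=> a _ ->; exists (a *: v); last by rewrite scalemxAl.
by apply/imsetP; exists a.
Qed.

Definition PG1_act (L : PG1) (A : {'GL_2[F]}) : PG1 :=
  exist _ (line_image (val L) A) (line_imageP L A).

Fact PG1_act1 : PG1_act^~ 1%g =1 id.
Proof.
move=> L; apply: val_inj; rewrite /= /line_image GL_1E.
by rewrite (eq_imset _ (fun v => mulmx1 v)) imset_id.
Qed.

Fact PG1_actM (L : PG1) : act_morph PG1_act L.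
Proof.
move=> A B; apply: val_inj; rewrite /= /line_image -imset_comp.
by apply: eq_imset => v; rewrite /comp -mulmxA.
Qed.

Canonical PG1_action := TotalAction PG1_act1 PG1_actM.

Definition SL2 : {set {'GL_2[F]}} := [set A | \det (GLval A) == 1].

Fact SL2_group_set : group_set SL2.
Proof.
apply/group_setP; split=> [|A B]; first by rewrite inE GL_1E det1.
by rewrite !inE GL_ME det_mulmx => /eqP-> /eqP->; rewrite mulr1.
Qed.
Canonical SL2_group := Group SL2_group_set.

Definition PSL2 : {group coset_of 'Z(SL2)} := (SL2 / 'Z(SL2))%G.

(* The group of permutations of PG(1,F) given by the quotient action of
   PSL(2,F): the centre of SL(2,F) fixes every point. *)
Definition PSL2_perm : {group {perm PG1}} :=
  (actperm (PG1_action %% 'Z(SL2)) @* PSL2)%G.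

Definition AGL1 : {set {perm F}} :=
  [set s : {perm F} |
     [exists a : F, exists b : F, (a != 0) && [forall x, s x == a * x + b]]].

Fact AGL1_group_set : group_set AGL1.
Proof.
apply/group_setP; split=> [|s t].
  rewrite inE; apply/existsP; exists 1; apply/existsP; exists 0.
  by rewrite oner_eq0; apply/forallP=> x; rewrite perm1 mul1r addr0.
rewrite !inE => /existsP[a /existsP[b /andP[a0 /forallP sE]]].
case/existsP=> c /existsP[d /andP[c0 /forallP tE]].
apply/existsP; exists (c * a); apply/existsP; exists (c * b + d).
rewrite mulf_neq0 //; apply/forallP=> x.
by rewrite permM (eqP (tE _)) (eqP (sE _)) mulrDr mulrA addrA.
Qed.
Canonical AGL1_group := Group AGL1_group_set.

End Groups.

(* Main.v *)
Require Import Defs.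
From mathcomp Require Import all_boot all_order all_algebra.
From mathcomp Require Import all_fingroup all_solvable all_field.

(** Uniqueness. In a scheme of order 5 on four points the 24 triples of distinct
    points are divided between two nonempty relations. Two distinct points x, y
    can be completed by only two points, and both relations have positive third
    valency, so each of them contains exactly one of the two completions
    ([third_point_neg]). A transposition of coordinates either preserves or
    exchanges the two relations; the two adjacent transpositions do the same by
    the braid relation, and they cannot preserve the relations, since no set of
    triangles of the tetrahedron covers each edge exactly once
    ([ast4_tetrahedral]). Hence the first relation is a choice of a cyclic
    order on each face of the tetrahedron such that adjacent faces are
    coherently oriented. The tetrahedron has just two such orientations,
    opposite to each other ([tetrahedral_rigid]); one of them is [rel4] and the
    other is [rel5]. So the unordered set of relations is determined
    ([ast4_unique]), and any bijection between two four-element sets is an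
    isomorphism of schemes ([ast4_isomorphic]).

    Existence. The orbits on triples of a two-transitive group always form a
    scheme ([two_transitive_ast]), and a sharply two-transitive group on four
    points has exactly two orbits of distinct triples, so its scheme has order 5
    ([sharply_two_transitive_ast]). Both groups are of this kind: an affine map
    ax + b is determined by two values, and over the field with three elements a
    matrix of determinant 1 with two eigenlines is scalar, since ab = 1 implies
    a = b there ([PSL2_fix2]). By uniqueness their schemes coincide with the
    listed one, which is obtained from that of PSL(2, 3) ([listed_ast]). *)

Set Implicit Arguments.
Unset Strict Implicit.
Unset Printing Implicit Defensive.

(** * Relations on triples *)

Section Triples.

Lemma tuple3_eqE (T : eqType) (x y z x' y' z' : T) :
  ([tuple x; y; z] == [tuple x'; y'; z']) = [&& x == x', y == y' & z == z'].
Proof. by rewrite -val_eqE /= !eqseq_cons andbT. Qed.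

Lemma tuple3P (T : Type) (t : 3.-tuple T) : exists x y z, t = [tuple x; y; z].
Proof.
by case: t => [[|x [|y [|z []]]] // t3]; exists x, y, z; apply: val_inj.
Qed.

Lemma setP3 (T : finType) (A B : {set 3.-tuple T}) :
  (forall x y z, ([tuple x; y; z] \in A) = ([tuple x; y; z] \in B)) -> A = B.
Proof. by move=> eqAB; apply/setP=> t; have [x [y [z ->]]] := tuple3P t. Qed.

Variable T : finType.
Implicit Types x y z : T.

Lemma triv0E x y z : ([tuple x; y; z] \in triv0 T) = (x == y) && (y == z).
Proof.
apply/imsetP/andP=> [[u _ /eqP]|[/eqP-> /eqP->]]; last by exists z.
by rewrite tuple3_eqE => /and3P[/eqP-> /eqP-> /eqP->].
Qed.

Lemma triv1E x y z : ([tuple x; y; z] \in triv1 T) = (x != y) && (y == z).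
Proof.
apply/imset2P/andP=> [[u v _ + /eqP]|[xy /eqP yz]].
  by rewrite !inE tuple3_eqE => uv /and3P[/eqP-> /eqP-> /eqP->].
by exists z x; rewrite ?inE ?yz // -yz.
Qed.

Lemma triv2E x y z : ([tuple x; y; z] \in triv2 T) = (x == z) && (x != y).
Proof.
apply/imset2P/andP=> [[u v _ + /eqP]|[/eqP xz xy]].
  by rewrite !inE tuple3_eqE eq_sym => uv /and3P[/eqP-> /eqP-> /eqP->].
by exists x y; rewrite ?inE ?(eq_sym y) // xz.
Qed.

Lemma triv3E x y z : ([tuple x; y; z] \in triv3 T) = (x == y) && (x != z).
Proof.
apply/imset2P/andP=> [[u v _ + /eqP]|[/eqP xy xz]].
  by rewrite !inE tuple3_eqE eq_sym => uv /and3P[/eqP-> /eqP-> /eqP->].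
by exists x z; rewrite ?inE ?(eq_sym z) // xy.
Qed.

Definition trivE := (triv0E, triv1E, triv2E, triv3E).

(** The pointwise form of the partition axioms, in which all the later arguments
    about disjointness and covering are carried out. *)
Lemma indexed_partitionP m (R : 'I_m -> {set 3.-tuple T}) :
  (partition [set R i | i : 'I_m] [set: 3.-tuple T] /\ injective R) <->
  [/\ forall i, R i != set0, forall t, exists i, t \in R i
    & forall i j t, t \in R i -> t \in R j -> i = j].
Proof.
split=> [[/and3P[/eqP cov /trivIsetP triv ne0] injR]|[ne0 cov uniR]].
  split=> [i|t|i j t Ri Rj].
  - by apply: contraNneq ne0 => Ri0; rewrite -Ri0 imset_f.
  - have: t \in cover [set R i | i : 'I_m] by rewrite cov inE.
    by case/bigcupP=> _ /imsetP[i _ ->]; exists i.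
  have RS k : R k \in [set R i | i : 'I_m] by apply: imset_f.
  apply/injR/eqP; apply: contraT => /(triv _ _ (RS i) (RS j))/pred0P/(_ t)/=.
  by rewrite Ri Rj.
have dis: {in 'I_m &, forall i j, j != i -> [disjoint R i & R j]}.
  move=> i j _ _; apply: contraNT => /pred0Pn[t /= /andP[Ri Rj]].
  by rewrite (uniR _ _ _ Ri Rj).
have [part injR] := indexed_partition dis (fun i _ => ne0 i).
split; last exact: in2T.
suff covT: cover [set R i | i : 'I_m] = setT by rewrite -covT.
apply/setP=> t; rewrite inE; have [i Ri] := cov t.
by apply/bigcupP; exists (R i); rewrite ?imset_f.
Qed.

Lemma permute_relE (s : 'S_3) (A : {set 3.-tuple T}) t :
  (t \in permute_rel s A) = ([tuple tnth t (s^-1%g i) | i < 3] \in A).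
Proof.
apply/imsetP/idP=> [[u Au ->]|At].
  rewrite (_ : mktuple _ = u) //.
  by apply: eq_from_tnth => i; rewrite !tnth_mktuple permKV.
exists [tuple tnth t (s^-1%g i) | i < 3] => //.
by apply: eq_from_tnth => i; rewrite !tnth_mktuple permK.
Qed.

End Triples.

(** * Transport and reindexing of schemes *)

Section Transport.

Variables (T T' : finType) (f : T -> T') (g : T' -> T).
Hypotheses (fK : cancel f g) (gK : cancel g f).

Lemma image_relE (A : {set 3.-tuple T}) x y z :
  ([tuple x; y; z] \in image_rel f A) = ([tuple g x; g y; g z] \in A).
Proof.
apply/imsetP/idP=> [[t]|At].
  have [u [v [w ->]]] := tuple3P t => At /eqP.
  rewrite (_ : map_tuple f _ = [tuple f u; f v; f w]); last exact: val_inj.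
  by rewrite tuple3_eqE => /and3P[/eqP-> /eqP-> /eqP->]; rewrite !fK.
exists [tuple g x; g y; g z] => //.
by apply: val_inj; rewrite /= !gK.
Qed.

Lemma permute_image_rel (s : 'S_3) (A : {set 3.-tuple T}) :
  permute_rel s (image_rel f A) = image_rel f (permute_rel s A).
Proof.
rewrite /permute_rel /image_rel -!imset_comp; apply: eq_imset => t /=.
by apply: eq_from_tnth => i; rewrite !(tnth_map, tnth_mktuple).
Qed.

Lemma image_rel_ast m (R : 'I_m.+1 -> {set 3.-tuple T}) :
  is_ast R -> is_ast (fun i => image_rel f (R i)).
Proof.
have bijf : bijective f by exists g.
have bijg : bijective g by exists f.
have injf := bij_inj bijf; have injg := bij_inj bijg.
move=> [cardT m4 part injR val3 intR symR R0 R1 R2 R3].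
have [ne0 cov uniR] := (indexed_partitionP R).1 (conj part injR).
have [|part' injR'] := (indexed_partitionP (fun i => image_rel f (R i))).2.
  split=> [i|t|i j t].
  - have /set0Pn[t Rt] := ne0 i.
    by apply/set0Pn; exists (map_tuple f t); apply: imset_f.
  - have [x [y [z ->]]] := tuple3P t.
    have [i Ri] := cov [tuple g x; g y; g z].
    by exists i; rewrite image_relE.
  by have [x [y [z ->]]] := tuple3P t; rewrite !image_relE; apply: uniR.
split=> //.
- by rewrite -(bij_eq_card bijf).
- move=> i; have [n Rn] := val3 i; exists n => x y xy.
  rewrite -(Rn (g x) (g y)) ?(inj_eq injg) //.
  rewrite -[RHS](on_card_preimset (onW_bij _ bijg)).
  by apply: eq_card => z; rewrite !inE image_relE.
- move=> i j k l; have [p Rp] := intR i j k l; exists p => x y z.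
  rewrite image_relE => /Rp <-.
  rewrite -[RHS](on_card_preimset (onW_bij _ bijg)).
  by apply: eq_card => w; rewrite !inE !image_relE.
- move=> i s; have [j Rj] := symR i s; exists j.
  by rewrite permute_image_rel Rj.
- by rewrite R0; apply: setP3 => x y z; rewrite image_relE !trivE ?inj_eq.
- by rewrite R1; apply: setP3 => x y z; rewrite image_relE !trivE ?inj_eq.
- by rewrite R2; apply: setP3 => x y z; rewrite image_relE !trivE ?inj_eq.
- by rewrite R3; apply: setP3 => x y z; rewrite image_relE !trivE ?inj_eq.
Qed.

End Transport.

Lemma reindex_ast (T : finType) m (R : 'I_m.+1 -> {set 3.-tuple T})
    (p : {perm 'I_m.+1}) :
  (forall i : 'I_m.+1, (i < 4)%N -> p i = i) -> is_ast R -> is_ast (R \o p).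
Proof.
move=> p4 [cardT m4 part injR val3 intR symR R0 R1 R2 R3].
have pk k : (k < 4)%N -> p (inord k) = inord k.
  by move=> k4; apply: p4; rewrite inordK // ltnS (leq_trans (ltnW k4)).
split=> //=; rewrite ?pk //.
- rewrite (_ : [set _ | i : _] = [set R i | i : 'I_m.+1]) //.
  apply/setP=> A; apply/imsetP/imsetP=> -[i _ ->]; first by exists (p i).
  by exists (p^-1%g i); rewrite //= permKV.
- exact: inj_comp injR perm_inj.
- by move=> i s; have [j Rj] := symR (p i) s; exists (p^-1%g j); rewrite permKV.
Qed.

(** * Orientations of triangles *)

(** F orients each triple of distinct points: the first two clauses make F an
    alternating function of its arguments, so that F selects one of the two
    cyclic orders of each triangle, and the third says that the two triangles
    on an edge xy induce opposite orientations on it. On four points this is a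
    coherent orientation of the boundary of a tetrahedron. *)
Definition tetrahedral (T : eqType) (F : T -> T -> T -> bool) :=
  [/\ forall x y z, uniq [:: x; y; z] -> F y x z = ~~ F x y z,
      forall x y z, uniq [:: x; y; z] -> F x z y = ~~ F x y z
    & forall x y z w, uniq [:: x; y; z; w] -> F x y w = ~~ F x y z].

Lemma uniq3E (T : eqType) (x y z : T) :
  uniq [:: x; y; z] = [&& x != y, x != z & y != z].
Proof. by rewrite /= !inE negb_or andbT -andbA. Qed.

Lemma uniq4E (T : eqType) (x y z w : T) :
  uniq [:: x; y; z; w] =
    [&& x != y, x != z, x != w, y != z, y != w & z != w].
Proof. by rewrite /= !inE !negb_or andbT -!andbA. Qed.

(** A connected surface has at most two coherent orientations. Each clause
    changes F and G alike, so their difference E is invariant under permuting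
    the arguments and under replacing the last one; any two triples are then
    linked by replacing one entry at a time. *)
Lemma tetrahedral_rigid (T : eqType) (F G : T -> T -> T -> bool)
    x y z x' y' z' :
    tetrahedral F -> tetrahedral G ->
    uniq [:: x; y; z] -> uniq [:: x'; y'; z'] ->
  F x y z (+) G x y z = F x' y' z' (+) G x' y' z'.
Proof.
move=> [F1 F2 F3] [G1 G2 G3]; pose E a b c := F a b c (+) G a b c.
rewrite -!/(E _ _ _).
have E1 a b c : uniq [:: a; b; c] -> E b a c = E a b c.
  by move=> abc; rewrite /E (F1 a) // (G1 a) // addbN addNb negbK.
have E2 a b c : uniq [:: a; b; c] -> E a c b = E a b c.
  by move=> abc; rewrite /E (F2 a) // (G2 a) // addbN addNb negbK.
have E3 a b c d : uniq [:: a; b; c] -> uniq [:: a; b; d] -> E a b d = E a b c.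
  have [-> //|cd] := eqVneq c d.
  rewrite !uniq3E => /and3P[ab ac bc] /and3P[_ ad bd].
  have abcd: uniq [:: a; b; c; d] by rewrite uniq4E ab ac ad bc bd.
  by rewrite /E (F3 _ _ _ _ abcd) (G3 _ _ _ _ abcd) addbN addNb negbK.
have E4 a b c u v : uniq [:: a; b; c] -> uniq [:: a; u; v] -> E a b c = E a u v.
  move=> abc auv; have [bu|bu] := eqVneq b u.
    by rewrite bu in abc *; apply: E3.
  have abu: uniq [:: a; b; u].
    by move: abc auv; rewrite !uniq3E bu => /and3P[-> _ _] /and3P[-> _ _].
  have aub: uniq [:: a; u; b].
    by move: abu; rewrite !uniq3E andbCA (eq_sym u).
  by rewrite (E3 a b u c) // -(E2 a b u) // (E3 a u v b).
have [<-{x'} xyz xyz'|xx' xyz xyz'] := eqVneq x x'; first exact: E4.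
have [w xx'w]: exists w, uniq [:: x; x'; w].
  move: xyz; rewrite uniq3E => /and3P[xy xz yz]; have [yx'|yx'] := eqVneq x' y.
    by exists z; rewrite uniq3E xx' xz yx'.
  by exists y; rewrite uniq3E xx' xy yx'.
rewrite (E4 x y z x' w) // -(E1 x x' w) //; apply: E4 => //.
by move: xx'w; rewrite !uniq3E (eq_sym x' x) => /and3P[-> -> ->].
Qed.

(** * Schemes of order 5 on four points *)

Section Order5.

Lemma card4_points (T : finType) : #|T| = 4 ->
  exists a b c d : T,
    uniq [:: a; b; c; d] /\ forall x, x \in [:: a; b; c; d].
Proof.
move=> T4; have := enum_uniq T; have := mem_enum T.
have: size (enum T) = 4 by rewrite -cardE.
case: (enum T) => [|a [|b [|c [|d []]]]] // _ mem_s uniq_s.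
by exists a, b, c, d; split=> // x; rewrite mem_s.
Qed.

Variables (T : finType) (S : 'I_6 -> {set 3.-tuple T}).
Hypotheses (T4 : #|T| = 4) (astS : is_ast S).

Let S4 x y z := [tuple x; y; z] \in S (inord 4).

Lemma ord6P (i : 'I_6) :
  [\/ i = inord 0, i = inord 1, i = inord 2 | i = inord 3]
  \/ i = inord 4 \/ i = inord 5.
Proof.
rewrite -(inord_val i); case: i => [[|[|[|[|[|[|//]]]]]] ?] /=.
- by left; constructor 1.
- by left; constructor 2.
- by left; constructor 3.
- by left; constructor 4.
- by right; left.
by right; right.
Qed.

(** The four trivial relations are exactly the possible patterns of coincidence
    among the entries of a triple that is not injective. *)
Lemma ast4_nontrivialE (i : 'I_6) x y z : [tuple x; y; z] \in S i ->
  uniq [:: x; y; z] = (i \in [:: inord 4; inord 5]).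
Proof.
case: astS => _ _ part injS _ _ _ E0 E1 E2 E3 Sxyz.
have [_ _ uniS] := (indexed_partitionP S).1 (conj part injS).
have inordE a b : (a < 6)%N -> (b < 6)%N ->
    ((inord a : 'I_6) == inord b) = (a == b).
  by move=> a6 b6; rewrite -val_eqE /= !inordK.
rewrite uniq3E !inE; have [xy|xy] /= := eqVneq x y.
  have [xz|xz] := eqVneq x z.
    rewrite (uniS i (inord 0) _ Sxyz) ?inordE //.
    by rewrite E0 trivE -xz -xy !eqxx.
  by rewrite (uniS i (inord 3) _ Sxyz) ?inordE // E3 trivE -xy eqxx.
have [xz|xz] /= := eqVneq x z.
  by rewrite (uniS i (inord 2) _ Sxyz) ?inordE // E2 trivE xz eqxx -xz.
have [yz|yz] /= := eqVneq y z.
  by rewrite (uniS i (inord 1) _ Sxyz) ?inordE // E1 trivE yz eqxx -yz xy.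
case: (ord6P i) Sxyz => [[] ->|[] ->]; rewrite ?inordE //.
- by rewrite E0 trivE (negPf xy).
- by rewrite E1 trivE (negPf yz) andbF.
- by rewrite E2 trivE (negPf xz).
- by rewrite E3 trivE (negPf xy).
Qed.

Lemma ast4_rel5E x y z :
  ([tuple x; y; z] \in S (inord 5)) = uniq [:: x; y; z] && ~~ S4 x y z.
Proof.
case: (astS) => _ _ part injS _ _ _ _ _ _ _.
have [_ covS uniS] := (indexed_partitionP S).1 (conj part injS).
have neq45 : (inord 4 : 'I_6) <> inord 5.
  by move/(congr1 val); rewrite /= !inordK.
apply/idP/andP=> [S5|[xyz nS4]].
  rewrite (ast4_nontrivialE S5) !inE eqxx orbT; split=> //.
  by apply/negP=> /uniS/(_ S5).
have [i Si] := covS [tuple x; y; z].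
move: xyz; rewrite (ast4_nontrivialE Si) !inE => /orP[] /eqP def_i.
  by rewrite /S4 -def_i Si in nS4.
by rewrite -def_i.
Qed.

Lemma ast4_rel4_uniq x y z : S4 x y z -> uniq [:: x; y; z].
Proof. by move/ast4_nontrivialE->; rewrite !inE eqxx. Qed.

Lemma ast4_points x y z w : uniq [:: x; y; z; w] ->
  forall u : T, u \in [:: x; y; z; w].
Proof.
move=> uniq_s; have /subset_cardP eqT: #|[:: x; y; z; w]| = #|T|.
  by rewrite T4; apply/card_uniqP.
by apply: (eqT (subset_predT _)).
Qed.

(** Each of the two nontrivial relations is nonempty, so it has positive third
    valency; only z and w can extend x and y to a distinct triple, hence each
    relation receives one of them. *)
Lemma third_point_neg x y z w :
  uniq [:: x; y; z; w] -> S4 x y w = ~~ S4 x y z.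
Proof.
case: (astS) => _ _ part injS valS _ _ _ _ _ _.
have [neS _ _] := (indexed_partitionP S).1 (conj part injS).
move=> uniq_s; have xy: x != y by move: uniq_s; rewrite uniq4E => /and3P[].
have third i : i \in [:: inord 4; inord 5 : 'I_6] ->
    exists2 c, c \in [:: z; w] & [tuple x; y; c] \in S i.
  move=> i45; have /set0Pn[t St] := neS i; move: St.
  have [a [b [c ->]]] := tuple3P t => Sabc.
  move: (ast4_nontrivialE Sabc); rewrite i45 uniq3E => /and3P[ab _ _].
  have [n Sn] := valS i.
  have: (0 < #|[set c | [tuple x; y; c] \in S i]|)%N.
    rewrite (Sn x y xy) -(Sn a b ab).
    by apply/card_gt0P; exists c; rewrite inE.
  case/card_gt0P=> d; rewrite inE => Sd; exists d => //.
  move: (ast4_nontrivialE Sd) (ast4_points uniq_s d).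
  by rewrite i45 uniq3E !inE => /and3P[_ /negPf xd /negPf yd];
    rewrite !(eq_sym d) xd yd.
have [|c czw Sc] := third (inord 4); first by rewrite !inE eqxx.
have [|d dzw] := third (inord 5); first by rewrite !inE eqxx orbT.
rewrite ast4_rel5E => /andP[_ Sd]; move: Sc Sd czw dzw; rewrite -/(S4 x y c).
rewrite !inE => Sc Sd /pred2P[cE|cE] /pred2P[dE|dE]; subst c d.
- by rewrite Sc in Sd.
- by rewrite Sc (negPf Sd).
- by rewrite Sc (negPf Sd).
by rewrite Sc in Sd.
Qed.

(** A permutation of the coordinates maps the first nontrivial relation either
    to itself or to the other one, which is its complement among the distinct
    triples; the boolean e tells which. *)
Lemma transposition_twist (a b : 'I_3) : exists e : bool,
  forall x y z (t := [tuple x; y; z]), uniq t ->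
  ([tuple tnth t (tperm a b i) | i < 3] \in S (inord 4)) = S4 x y z (+) e.
Proof.
case: (astS) => _ _ part injS _ _ symS _ _ _ _.
have [neS _ _] := (indexed_partitionP S).1 (conj part injS).
have [j Sj] := symS (inord 4) (tperm a b).
have SjE t :
    ([tuple tnth t (tperm a b i) | i < 3] \in S (inord 4)) = (t \in S j).
  by rewrite -Sj permute_relE tpermV.
have /set0Pn[t St] := neS (inord 4).
have Ut : uniq t.
  by move: t St => t; have [x [y [z ->]]] := tuple3P t => /ast4_rel4_uniq.
move: St; pose u := [tuple tnth t (tperm a b i) | i < 3].
have -> : t = [tuple tnth u (tperm a b i) | i < 3].
  by apply: eq_from_tnth => i; rewrite !tnth_mktuple tpermK.
rewrite SjE => Su.
have Uu: uniq u.
  apply/tuple_uniqP=> i j'; rewrite !tnth_mktuple.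
  by move/(tuple_uniqP _ Ut)/perm_inj.
have: j \in [:: inord 4; inord 5 : 'I_6].
  move: u Su Uu => u; have [x [y [z ->]]] := tuple3P u.
  by move/ast4_nontrivialE <-.
rewrite !inE => /orP[]/eqP def_j.
  by exists false => x y z t1 _; rewrite SjE def_j addbF.
by exists true => x y z t1 Ut1; rewrite SjE def_j ast4_rel5E Ut1 addbT.
Qed.

Lemma swap01_twist : exists e : bool,
  forall x y z, uniq [:: x; y; z] -> S4 y x z = S4 x y z (+) e.
Proof.
have [e twist] := transposition_twist (@Ordinal 3 0 isT) (@Ordinal 3 1 isT).
exists e => x y z /(twist x y z) <-.
rewrite (_ : mktuple _ = [tuple y; x; z]) //.
apply: eq_from_tnth => i; rewrite tnth_mktuple !(tnth_nth x).
by case: tpermP => [->|->|] //; case: i => [[|[|[|//]]] ?] //= i0 i1;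
  [case: i0 | case: i1]; apply: val_inj.
Qed.

Lemma swap12_twist : exists e : bool,
  forall x y z, uniq [:: x; y; z] -> S4 x z y = S4 x y z (+) e.
Proof.
have [e twist] := transposition_twist (@Ordinal 3 1 isT) (@Ordinal 3 2 isT).
exists e => x y z /(twist x y z) <-.
rewrite (_ : mktuple _ = [tuple x; z; y]) //.
apply: eq_from_tnth => i; rewrite tnth_mktuple !(tnth_nth x).
by case: tpermP => [->|->|] //; case: i => [[|[|[|//]]] ?] //= i1 i2;
  [case: i1 | case: i2]; apply: val_inj.
Qed.

(** The braid relation between the two adjacent transpositions forces them to
    act by the same sign e; the valency then excludes e = false. *)
Lemma ast4_tetrahedral : tetrahedral S4.
Proof.
have [e sw01] := swap01_twist; have [e' sw12] := swap12_twist.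
have [a [b [c [d [Uabcd _]]]]] := card4_points T4.
have D: (a != b) * (a != c) * (a != d) * (b != c) * (b != d) * (c != d) *
  ((b != a) * (c != a) * (d != a) * (c != b) * (d != b) * (d != c)).
  rewrite (eq_sym b a) (eq_sym c a) (eq_sym d a) (eq_sym c b) (eq_sym d b)
    (eq_sym d c).
  by move: Uabcd; rewrite uniq4E => /and5P[-> -> -> -> /andP[-> ->]].
(* Both sides of the braid relation reverse the triple abc. *)
have eqe: e = e'.
  have p1: S4 c b a = S4 a b c (+) e (+) e' (+) e.
    by rewrite -(sw01 a b c) -?(sw12 b a c) -?(sw01 b c a) // uniq3E !D.
  have p2: S4 c b a = S4 a b c (+) e' (+) e (+) e'.
    by rewrite -(sw12 a b c) -?(sw01 a c b) -?(sw12 c a b) // uniq3E !D.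
  by move: p1; rewrite p2; case: (S4 a b c) e e' {sw01 sw12 p2} => [] [] [].
(* A symmetric relation would be a set of triangles of the tetrahedron covering
   each edge exactly once; the edges ab, bc and bd already rule this out. *)
have e1: e = true.
  case: e eqe sw01 => [//|] eqe sw01; rewrite -eqe in sw12.
  have bcd: S4 b c d = ~~ S4 a b c.
    rewrite (third_point_neg (y := c) (z := a)) ?uniq4E ?D //.
    by rewrite (sw12 b a c) ?(sw01 a b c) ?addbF // uniq3E !D.
  have bdc: S4 b d c = S4 a b c.
    rewrite (third_point_neg (y := d) (z := a)) ?uniq4E ?D //.
    rewrite (sw12 b a d) ?(sw01 a b d) ?addbF ?uniq3E ?D //.
    by rewrite (third_point_neg Uabcd) negbK.
  move: (sw12 b c d); rewrite uniq3E !D bcd bdc addbF => /(_ isT).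
  by case: (S4 a b c).
split=> [x y z Uxyz|x y z Uxyz|]; last exact: third_point_neg.
  by rewrite sw01 // e1 addbT.
by rewrite sw12 // -eqe e1 addbT.
Qed.

Lemma ast4_rel4E x y z :
  S4 x y z = uniq [:: x; y; z] && S4 x y z.
Proof. by case Sxyz: (S4 x y z); rewrite ?andbF // (ast4_rel4_uniq Sxyz). Qed.

End Order5.

(** The listed triples in terms of the values of ordinals, where membership is
    decided by computation. *)
Definition rel4_code : seq (seq nat) :=
  [:: [:: 0; 1; 2]; [:: 0; 2; 3]; [:: 0; 3; 1]; [:: 1; 0; 3]; [:: 1; 2; 0];
      [:: 1; 3; 2]; [:: 2; 0; 1]; [:: 2; 1; 3]; [:: 2; 3; 0]; [:: 3; 0; 2];
      [:: 3; 1; 0]; [:: 3; 2; 1]]%N.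

Definition rel5_code : seq (seq nat) :=
  [:: [:: 0; 1; 3]; [:: 0; 2; 1]; [:: 0; 3; 2]; [:: 1; 0; 2]; [:: 1; 2; 3];
      [:: 1; 3; 0]; [:: 2; 0; 3]; [:: 2; 1; 0]; [:: 2; 3; 1]; [:: 3; 0; 1];
      [:: 3; 1; 2]; [:: 3; 2; 0]]%N.

Lemma rel4E (t : 3.-tuple 'I_4) : (t \in rel4) = (map val t \in rel4_code).
Proof.
rewrite inE -(mem_map val_inj) -(mem_map (inj_map val_inj)) -map_comp /=.
by rewrite !inordK.
Qed.

Lemma rel5E (t : 3.-tuple 'I_4) : (t \in rel5) = (map val t \in rel5_code).
Proof.
rewrite inE -(mem_map val_inj) -(mem_map (inj_map val_inj)) -map_comp /=.
by rewrite !inordK.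
Qed.

Lemma rel4_tetrahedral :
  tetrahedral (fun x y z : 'I_4 => [tuple x; y; z] \in rel4).
Proof.
split=> [x y z|x y z|x y z w]; rewrite !rel4E -(map_inj_uniq val_inj) /=.
- by case: x y z => [[|[|[|[|//]]]] ?] [[|[|[|[|//]]]] ?] [[|[|[|[|//]]]] ?].
- by case: x y z => [[|[|[|[|//]]]] ?] [[|[|[|[|//]]]] ?] [[|[|[|[|//]]]] ?].
by case: x y z w => [[|[|[|[|//]]]] ?] [[|[|[|[|//]]]] ?] [[|[|[|[|//]]]] ?]
   [[|[|[|[|//]]]] ?].
Qed.

Lemma rel45_uniqE (x y z : 'I_4) :
  (([tuple x; y; z] \in rel4) =
     uniq [:: x; y; z] && ([tuple x; y; z] \in rel4)) *
  (([tuple x; y; z] \in rel5) =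
     uniq [:: x; y; z] && ([tuple x; y; z] \notin rel4)).
Proof.
rewrite !rel4E rel5E -(map_inj_uniq val_inj) /=.
by case: x y z => [[|[|[|[|//]]]] ?] [[|[|[|[|//]]]] ?] [[|[|[|[|//]]]] ?].
Qed.

(** Both the scheme and the listed relation orient the tetrahedron coherently,
    so by rigidity they agree up to a global reversal, which is the exchange of
    the two nontrivial relations. *)
Lemma ast4_unique (S : 'I_6 -> {set 3.-tuple 'I_4}) : is_ast S ->
  (S (inord 4) = rel4 /\ S (inord 5) = rel5) \/
  (S (inord 4) = rel5 /\ S (inord 5) = rel4).
Proof.
move=> astS; have I4 := card_ord 4.
have tetS := ast4_tetrahedral I4 astS.
have [a [b [c [d [Uabcd _]]]]] := card4_points I4.
have Uabc: uniq [:: a; b; c].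
  by move: Uabcd; rewrite uniq3E uniq4E => /and5P[-> -> _ ->].
have {}rigid x y z (Uxyz : uniq [:: x; y; z]) :=
  tetrahedral_rigid tetS rel4_tetrahedral Uxyz Uabc.
move: (_ (+) _) rigid => e rigid.
have agree x y z : uniq [:: x; y; z] -> ([tuple x; y; z] \in S (inord 4)) =
    e (+) ([tuple x; y; z] \in rel4).
  by move/rigid=> <-; rewrite -addbA addbb addbF.
case: e agree {rigid} => agree; [right|left]; split; apply: setP3 => x y z.
- rewrite (ast4_rel4E astS) (rel45_uniqE x y z).2.
  by apply: andb_id2l => /agree->.
- rewrite (ast4_rel5E astS) (rel45_uniqE x y z).1.
  by apply: andb_id2l => /agree->; rewrite negbK.
- rewrite (ast4_rel4E astS) (rel45_uniqE x y z).1.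
  by apply: andb_id2l => /agree->.
rewrite (ast4_rel5E astS) (rel45_uniqE x y z).2.
by apply: andb_id2l => /agree->.
Qed.

Lemma card4_enum (T : finType) : #|T| = 4 ->
  exists (f : 'I_4 -> T), exists2 g : T -> 'I_4, cancel f g & cancel g f.
Proof.
move=> T4; exists (fun i => enum_val (cast_ord (esym T4) i)).
exists (fun x => cast_ord T4 (enum_rank x)).
  by move=> i; rewrite enum_valK cast_ordKV.
by move=> x; rewrite cast_ordK enum_rankK.
Qed.

Lemma ast4_set (T : finType) (S : 'I_6 -> {set 3.-tuple T}) :
  is_ast S ->
  [set S i | i : 'I_6] =
    [set triv0 T; triv1 T; triv2 T; triv3 T]
      :|: [set S (inord 4); S (inord 5)].
Proof.
case=> _ _ _ _ _ _ _ E0 E1 E2 E3; apply/setP=> A; rewrite !inE -!orbA.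
rewrite -E0 -E1 -E2 -E3.
apply/imsetP/idP=> [[i _ ->]|].
  by case: (ord6P i) => [[] ->|[] ->]; rewrite eqxx ?orbT.
by do 5![case/predU1P=> [->|]; first by [eexists]]; move/eqP->; eexists.
Qed.

(** Pulling S back to 'I_4 along an enumeration of T gives a scheme with the
    same set of relations as R, so that any enumeration is an isomorphism. *)
Lemma ast4_isomorphic (T : finType) (R : 'I_6 -> {set 3.-tuple 'I_4})
    (S : 'I_6 -> {set 3.-tuple T}) :
  #|T| = 4 -> is_ast R -> is_ast S -> ast_isomorphic R S.
Proof.
move=> /card4_enum[f [g fK gK]] astR astS.
exists f; first by exists g.
have astS' := image_rel_ast gK fK astS.
have eqRS : [set R i | i : 'I_6] = [set image_rel g (S i) | i : 'I_6].
  rewrite (ast4_set astR) (ast4_set astS'); congr (_ :|: _).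
  have listed (Q : 'I_6 -> {set 3.-tuple 'I_4}) : is_ast Q ->
      [set Q (inord 4); Q (inord 5)] = [set rel4; rel5].
    by case/ast4_unique=> [[-> ->]|[-> ->]]; [reflexivity | exact: setUC].
  by rewrite (listed _ astR); apply: esym (listed _ astS').
rewrite (imset_comp (image_rel f) R) eqRS -imset_comp; apply: eq_imset => i /=.
by apply: setP3 => x y z; rewrite (image_relE fK gK) (image_relE gK fK) !gK.
Qed.

(** * Orbits of two-transitive groups *)

Section TwoTransitive.

Variables (T : finType) (H : {group {perm T}}).
Hypothesis H2 : forall x y u v : T, x != y -> u != v ->
  exists2 h : {perm T}, h \in H & h x = u /\ h y = v.

Let orb (t : 3.-tuple T) := orbit ('P * 3)%act H t.

Lemma act3E (h : {perm T}) x y z :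
  ('P * 3)%act [tuple x; y; z] h = [tuple h x; h y; h z].
Proof. exact: val_inj. Qed.

Lemma orbit3P x y z x' y' z' :
  reflect (exists2 h : {perm T}, h \in H & [/\ h x = x', h y = y' & h z = z'])
    ([tuple x'; y'; z'] \in orb [tuple x; y; z]).
Proof.
apply: (iffP orbitP) => -[h Hh].
  rewrite act3E => /eqP; rewrite tuple3_eqE => /and3P[/eqP ? /eqP ? /eqP ?].
  by exists h.
by case=> <- <- <-; exists h; rewrite ?act3E.
Qed.

Lemma two_transitive : (2 <= #|T|)%N -> [transitive^2 H, on [set: T] | 'P].
Proof.
case/card_gt1P=> a [b [_ _ ab]]; apply/imsetP; exists [tuple a; b].
  by rewrite !inE /= inE ab subset_all /= !inE.
apply/setP=> t; case: t => [[|u [|v []]]] // t2.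
rewrite !inE /= inE andbT.
apply/andP/orbitP=> [[uv _]|[h Hh /(congr1 val)/= ht]].
  have [h Hh [hu hv]] := H2 ab uv; exists h => //.
  by apply: val_inj; rewrite /= /aperm hu hv.
by case: ht => <- <-; rewrite (inj_eq perm_inj) ab.
Qed.

(** The counts in the axioms are constant because an element of H carries the
    configuration at one base pair, or base triple, bijectively to that at any
    other; coordinate permutations commute with the diagonal action, hence
    permute the orbits. *)
Lemma two_transitive_ast m (R : 'I_m.+1 -> {set 3.-tuple T}) :
    (3 <= #|T|)%N -> (4 <= m)%N -> injective R ->
    [set R i | i : 'I_m.+1] = triple_orbits H ->
    R (inord 0) = triv0 T -> R (inord 1) = triv1 T ->
    R (inord 2) = triv2 T -> R (inord 3) = triv3 T ->
  is_ast R.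
Proof.
move=> T3 m4 injR setR R0 R1 R2 R3.
have Rorb i : exists t, R i = orb t.
  have: R i \in triple_orbits H by rewrite -setR imset_f.
  by case/imsetP=> t _ ->; exists t.
have Racts i h x y z : h \in H ->
    ([tuple h x; h y; h z] \in R i) = ([tuple x; y; z] \in R i).
  move=> Hh; have [t ->] := Rorb i.
  by rewrite -act3E /orb orbit_actr.
split=> //.
- rewrite setR; apply: orbit_partition; apply/subsetP=> h _.
  by rewrite !inE; apply/subsetP=> t _; rewrite !inE.
- move=> i; have [/card_gt1P[a [b [_ _ ab]]]] : (1 < #|T|)%N by apply: ltnW.
  exists #|[set z | [tuple a; b; z] \in R i]| => x y xy.
  have [h Hh [<- <-]] := H2 ab xy.
  rewrite -[LHS](card_preimset _ (@perm_inj _ h)).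
  by apply: eq_card => z; rewrite !inE Racts.
- move=> i j k l; have [t def_l] := Rorb l; move: def_l.
  have [a [b [c ->]]] := tuple3P t => def_l.
  exists #|[set w | [&& [tuple w; b; c] \in R i, [tuple a; w; c] \in R j
                      & [tuple a; b; w] \in R k]]| => x y z.
  rewrite def_l => /orbit3P[h Hh [<- <- <-]].
  rewrite -[LHS](card_preimset _ (@perm_inj _ h)).
  by apply: eq_card => w; rewrite !inE !Racts.
move=> i s; have [t def_i] := Rorb i.
have: orb [tuple tnth t (s i) | i < 3] \in triple_orbits H by apply: imset_f.
rewrite -setR => /imsetP[j _ def_j]; exists j; rewrite -def_j def_i.
apply/setP=> u; apply/imsetP/orbitP=> [[_ /orbitP[h Hh <-] ->]|[h Hh <-]].
  exists h => //; apply: eq_from_tnth => k.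
  by rewrite !(tnth_map, tnth_mktuple).
exists (('P * 3)%act t h); first exact: mem_orbit.
by apply: eq_from_tnth => k; rewrite !(tnth_map, tnth_mktuple).
Qed.

Hypothesis H1 : forall (h : {perm T}) x y, h \in H -> x != y ->
  h x = x -> h y = y -> h = 1%g.
Hypothesis T4 : #|T| = 4.

(** If only the identity of H fixes two points, an element of H is determined by
    its values at a and b. The distinct triples then fall into two orbits, those
    of abc and abd, according to the preimage of the third entry. *)
Lemma sharply_two_transitive_ast :
  exists S : 'I_6 -> {set 3.-tuple T}, induced_ast H S.
Proof.
have [a [b [c [d [Uabcd all_abcd]]]]] := card4_points T4.
move: (Uabcd); rewrite uniq4E => /and5P[ab ac ad bc /andP[bd cd]].
pose reps := [:: [tuple a; a; a]; [tuple b; a; a]; [tuple a; b; a];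
                 [tuple a; a; b]; [tuple a; b; c]; [tuple a; b; d]].
pose S (i : 'I_6) := orb (nth [tuple a; a; a] reps i).
have H1t x u : exists2 h : {perm T}, h \in H & h x = u.
  have other z : exists w : T, z != w.
    by have [->|za] := eqVneq z a; [exists b | exists a].
  have [y xy] := other x; have [v uv] := other u.
  by have [h Hh [hx _]] := H2 xy uv; exists h.
have S0: S (inord 0) = triv0 T.
  rewrite /S inordK //=; apply: setP3 => x y z; rewrite trivE.
  apply/orbit3P/andP=> [[h _ [<- <- <-]]|[/eqP-> /eqP->]].
    by rewrite !eqxx.
  by have [h Hh ha] := H1t a z; exists h.
have S1: S (inord 1) = triv1 T.
  rewrite /S inordK //=; apply: setP3 => x y z; rewrite trivE.
  apply/orbit3P/andP=> [[h _ [<- <- <-]]|[xy /eqP <-]].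
    by rewrite eqxx (inj_eq perm_inj) eq_sym.
  by move: xy; rewrite eq_sym => /(H2 ab)[h Hh [ha hb]]; exists h.
have S2: S (inord 2) = triv2 T.
  rewrite /S inordK //=; apply: setP3 => x y z; rewrite trivE.
  apply/orbit3P/andP=> [[h _ [<- <- <-]]|[/eqP <- xy]].
    by rewrite eqxx (inj_eq perm_inj).
  by have [h Hh [ha hb]] := H2 ab xy; exists h.
have S3: S (inord 3) = triv3 T.
  rewrite /S inordK //=; apply: setP3 => x y z; rewrite trivE.
  apply/orbit3P/andP=> [[h _ [<- <- <-]]|[/eqP <- xz]].
    by rewrite eqxx (inj_eq perm_inj).
  by have [h Hh [ha hb]] := H2 ab xz; exists h.
(* The pattern of coincidences among the entries is constant on orbits and
   separates all the representatives except the last two. *)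
pose eq_type (s : seq T) :=
  if s is [:: x; y; z] then [:: x != y; y != z; x != z] else [::].
have orb_type t t' : t' \in orb t -> eq_type t' = eq_type t.
  have [u [v [w ->]]] := tuple3P t; have [x [y [z ->]]] := tuple3P t'.
  by case/orbit3P=> h _ [<- <- <-]; rewrite /= !(inj_eq perm_inj).
have S45: [tuple a; b; c] \notin S (inord 5).
  rewrite /S inordK //=; apply/orbit3P=> -[h Hh [ha hb]].
  by rewrite (H1 Hh ab ha hb) perm1 => dc; rewrite dc eqxx in cd.
have injS: injective S.
  move=> i j eqS; apply: val_inj.
  have: nth [tuple a; a; a] reps i \in S j by rewrite -eqS; apply: orbit_refl.
  move: S45; rewrite /S inordK // {eqS}.
  have ba: b != a by rewrite eq_sym.
  case: i j => [[|[|[|[|[|[|//]]]]]] ?] [[|[|[|[|[|[|//]]]]]] ?] //= nS45;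
    try by move/orb_type; rewrite /= ?eqxx ?ab ?ba ?ac ?bc ?ad ?bd.
  - by rewrite (negPf nS45).
  by rewrite /orb orbit_sym (negPf nS45).
have setS: [set S i | i : 'I_6] = triple_orbits H.
  apply/setP=> A; apply/imsetP/imsetP=> -[]; first by move=> i _ ->; eexists.
  move=> t _ ->; suff [i Si]: exists i, t \in S i.
    by exists i => //; apply/orbit_eqP.
  have [x [y [z ->]]] := tuple3P t.
  have [xy|xy] := eqVneq x y.
    have [xz|xz] := eqVneq x z.
      by exists (inord 0); rewrite S0 trivE xy eqxx -xy xz eqxx.
    by exists (inord 3); rewrite S3 trivE xy eqxx -xy.
  have [xz|xz] := eqVneq x z.
    by exists (inord 2); rewrite S2 trivE xz eqxx -xz.
  have [yz|yz] := eqVneq y z.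
    by exists (inord 1); rewrite S1 trivE yz eqxx -yz xy.
  have [h Hh [ha hb]] := H2 ab xy; have := all_abcd (h^-1%g z).
  rewrite -(mem_map (@perm_inj _ h)) permKV /= ha hb !inE.
  rewrite (eq_sym z x) (eq_sym z y).
  rewrite (negPf xz) (negPf yz) /= => /pred2P[hc|hd].
    by exists (inord 4); rewrite /S inordK //=; apply/orbit3P; exists h.
  by exists (inord 5); rewrite /S inordK //=; apply/orbit3P; exists h.
exists S; split.
- by rewrite T4.
- by apply: two_transitive; rewrite T4.
- by apply: two_transitive_ast => //; rewrite T4.
exact: setS.
Qed.

End TwoTransitive.

(** * The affine and projective groups *)

Section Groups.

Import GRing.Theory GroupScope.
Local Open Scope ring_scope.

Variable F : finFieldType.

Lemma AGL1_two_transitive (x y u v : F) : x != y -> u != v ->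
  exists2 h : {perm F}, h \in AGL1_group F & h x = u /\ h y = v.
Proof.
move=> xy uv; pose m := (v - u) / (y - x).
have yx0: y - x != 0 by rewrite subr_eq0 eq_sym.
have m0: m != 0 by rewrite mulf_neq0 ?invr_eq0 // subr_eq0 eq_sym.
have inj_h: injective (fun z => m * z + (u - m * x)).
  by move=> z w /addIr/(mulfI m0).
exists (perm inj_h); last first.
  rewrite !permE addrC subrK; split=> //.
  by rewrite addrCA -mulrBr divfK // addrC subrK.
rewrite inE; apply/existsP; exists m; apply/existsP; exists (u - m * x).
by rewrite m0; apply/forallP=> z; rewrite permE.
Qed.

Lemma AGL1_fix2 (h : {perm F}) x y : h \in AGL1_group F -> x != y ->
  h x = x -> h y = y -> h = 1%g.
Proof.
rewrite inE => /existsP[m /existsP[n /andP[m0 /forallP hE]]] xy.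
have {}hE z : h z = m * z + n by apply/eqP.
rewrite !hE => hx hy.
have m1: m = 1.
  apply: (mulIf (_ : x - y != 0)); first by rewrite subr_eq0.
  have: (m * x + n) - (m * y + n) = m * (x - y).
    by rewrite opprD addrACA subrr addr0 mulrBr.
  by rewrite hx hy mul1r.
have n0: n = 0 by apply: (addrI x); rewrite addr0 -[RHS]hx m1 mul1r.
by apply/permP=> z; rewrite hE m1 n0 mul1r addr0 perm1.
Qed.

Definition span (v : 'rV[F]_2) : {set 'rV[F]_2} := [set a *: v | a : F].

Lemma spanP v w : reflect (exists a, w = a *: v) (w \in span v).
Proof. by apply: (iffP imsetP) => -[a]; exists a. Qed.

Lemma span_id v : v \in span v.
Proof. by apply/spanP; exists 1; rewrite scale1r. Qed.

Lemma spanZ c v : c != 0 -> span (c *: v) = span v.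
Proof.
move=> c0; apply/setP=> w; apply/spanP/spanP=> -[a ->].
  by exists (a * c); rewrite scalerA.
by exists (a / c); rewrite scalerA divfK.
Qed.

Lemma span_eq v w : w != 0 -> w \in span v -> span w = span v.
Proof.
move=> w0 /spanP[c def_w]; rewrite def_w spanZ //.
by apply: contraNneq w0 => c0; rewrite def_w c0 scale0r.
Qed.

Lemma span_is_line v : v != 0 -> is_line (span v).
Proof. by move=> v0; apply/existsP; exists v; rewrite v0 eqxx. Qed.

Lemma lineP (L : PG1 F) : exists2 v, v != 0 & val L = span v.
Proof.
by case: L => L /= /existsP[v /andP[v0 /eqP->]]; exists v.
Qed.

Lemma span_image (L : PG1 F) v A :
  val L = span v -> val (PG1_act L A) = span (v *m GLval A).
Proof.
rewrite /= /line_image => ->; apply/setP=> w.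
apply/imsetP/spanP=> [[_ /spanP[a ->] ->]|[a ->]].
  by exists a; rewrite scalemxAl.
by exists (a *: v); rewrite ?scalemxAl //; apply/spanP; exists a.
Qed.

Lemma scalar_fixes_lines (A : {'GL_2[F]}) a (L : PG1 F) :
  GLval A = a%:M -> PG1_act L A = L.
Proof.
move=> def_A; apply: val_inj; have [v v0 defL] := lineP L.
rewrite (span_image A defL) defL def_A mul_mx_scalar spanZ //.
apply: contraTneq (GL_unitmx A) => a0.
by rewrite /= -/(GLval A) def_A a0 unitmxE det_scalar expr0n unitr0.
Qed.

Definition basis_mx (v w : 'rV[F]_2) : 'M[F]_2 :=
  \matrix_(i < 2) (if i == 0 then v else w).

Lemma mul_basis_mx u v w : u *m basis_mx v w = u 0 0 *: v + u 0 1 *: w.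
Proof.
rewrite mulmx_sum_row !big_ord_recl big_ord0 addr0 !rowK /=.
by congr (_ + _ *: _); congr (u _ _); apply: val_inj.
Qed.

Lemma basis_mxM v w A : basis_mx v w *m A = basis_mx (v *m A) (w *m A).
Proof.
by apply/row_matrixP=> i; rewrite row_mul !rowK; case: ifP.
Qed.

Lemma basis_mx_inj v w v' w' :
  basis_mx v w = basis_mx v' w' -> v = v' /\ w = w'.
Proof.
by move=> eqB; split; [have := congr1 (row 0) eqB | have := congr1 (row 1) eqB];
  rewrite !rowK.
Qed.

Lemma basis_mxZ a b v w :
  \det (basis_mx (a *: v) (b *: w)) = a * b * \det (basis_mx v w).
Proof.
pose d := \row_(i < 2) (if i == 0 then a else b).
have ->: basis_mx (a *: v) (b *: w) = diag_mx d *m basis_mx v w.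
  apply/row_matrixP=> i; apply/rowP=> j; rewrite mul_diag_mx rowK !mxE.
  by case: ifP; rewrite !mxE.
by rewrite det_mulmx det_diag !big_ord_recl big_ord0 !mxE mulr1.
Qed.

Lemma basis_mx_unit v w : v != 0 -> w != 0 -> span v != span w ->
  \det (basis_mx v w) != 0.
Proof.
move=> v0 w0; apply: contraNneq => /eqP/det0P[u u0].
rewrite mul_basis_mx => /eqP; rewrite addr_eq0 => /eqP uvw.
have [u00|u00] := eqVneq (u 0 0) 0.
  move: uvw; rewrite u00 scale0r => /esym/eqP.
  rewrite oppr_eq0 scaler_eq0 (negPf w0) orbF => /eqP u01.
  case/eqP: u0; apply/rowP=> j; rewrite mxE.
  by case: j => [[|[|//]] ?]; [rewrite -[RHS]u00 | rewrite -[RHS]u01];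
    congr (u _ _); apply: val_inj.
apply/eqP/span_eq=> //; apply/spanP; exists (- ((u 0 0)^-1 * u 0 1)).
by rewrite scaleNr -scalerA -scalerN -uvw scalerA mulVf // scale1r.
Qed.

Lemma SL2_lift (M : 'M[F]_2) : \det M = 1 ->
  exists2 A : {'GL_2[F]}, A \in SL2 F & GLval A = M.
Proof.
move=> detM; have unitM: M \is a GRing.unit.
  by rewrite -[_ \is a _]/(M \in unitmx) unitmxE detM unitr1.
pose A : {'GL_2[F]} := FinRing.Unit unitM.
by exists A; rewrite ?inE /= ?detM.
Qed.

(** The matrix sending a basis (v, w) to (v', c w') has determinant 1 for a
    suitable c, and rescaling w' does not change the line it spans. *)
Lemma SL2_two_transitive (L M L' M' : PG1 F) : L != M -> L' != M' ->
  exists2 A, A \in SL2 F & PG1_act L A = L' /\ PG1_act M A = M'.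
Proof.
have [v v0 Lv] := lineP L; have [w w0 Mw] := lineP M.
have [v' v'0 Lv'] := lineP L'; have [w' w'0 Mw'] := lineP M'.
rewrite -!val_eqE /= Lv Mw Lv' Mw' => LM LM'.
have dV := basis_mx_unit v0 w0 LM; have dW := basis_mx_unit v'0 w'0 LM'.
set V := basis_mx v w in dV; pose c := \det V / \det (basis_mx v' w').
have c0: c != 0 by rewrite mulf_neq0 ?invr_eq0.
pose W := basis_mx (1 *: v') (c *: w'); pose M0 := invmx V *m W.
have VU : V \in unitmx by rewrite unitmxE unitfE.
have detA: \det M0 = 1.
  by rewrite det_mulmx det_inv basis_mxZ mul1r divfK // mulVf.
have [A SA def_A] := SL2_lift detA.
have [vA wA]: v *m GLval A = 1 *: v' /\ w *m GLval A = c *: w'.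
  by apply: basis_mx_inj; rewrite -basis_mxM -/V def_A mulKVmx.
exists A => //; split; apply: val_inj.
  by rewrite (span_image A Lv) vA spanZ ?oner_eq0.
by rewrite (span_image A Mw) wA spanZ.
Qed.

(** Commuting with the two elementary transvections already forces a matrix to
    be scalar. *)
Lemma SL2_center_scalar A : A \in 'Z(SL2 F) -> exists a, GLval A = a%:M.
Proof.
case/centerP=> _ cA.
have commA (B : 'M[F]_2) : \det B = 1 -> GLval A *m B = B *m GLval A.
  by case/SL2_lift=> C SC <-; have /(congr1 val) := cA C SC.
pose M : 'M[F]_(1 + 1) := GLval A.
have detU: \det (block_mx 1%:M 1%:M 0 1%:M : 'M[F]_(1 + 1)) = 1.
  by rewrite det_ublock !det1 mulr1.
have detL: \det (block_mx 1%:M 0 1%:M 1%:M : 'M[F]_(1 + 1)) = 1.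
  by rewrite det_lblock !det1 mulr1.
have: M *m _ = _ *m M := commA _ detU; have: M *m _ = _ *m M := commA _ detL.
rewrite -(submxK M) !mulmx_block.
rewrite !(mul1mx, mulmx1, mul0mx, mulmx0, addr0, add0r).
case/eq_block_mx=> eUL _ _ _ /eq_block_mx[_ eUR _ eDR].
have ur0: ursubmx M = 0 by apply: (addrI (ulsubmx M)); rewrite addr0.
have dl0: dlsubmx M = 0 by apply: (addIr (drsubmx M)); rewrite add0r.
have eqD: ulsubmx M = drsubmx M by move: eUR; rewrite ur0 addr0 add0r.
exists (ulsubmx M 0 0); rewrite -[LHS](submxK M) ur0 dl0 -eqD.
by rewrite [RHS](scalar_mx_block 1 1) -mx11_scalar.
Qed.

(** The quotient action is defined through the points fixed by the centre; all
    lines are, because central elements are scalar, so it can be computed on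
    representatives in SL(2, F). *)
Lemma PSL2_permP (h : {perm PG1 F}) : reflect
  (exists2 A, A \in SL2 F & forall L : PG1 F, h L = PG1_act L A)
  (h \in PSL2_perm F).
Proof.
have fixZ L : L \in 'Fix_(PG1_action F)([set: {'GL_2[F]}] :&: 'Z(SL2 F))%g.
  apply/afixP=> A /setIP[_ /SL2_center_scalar[a def_A]].
  exact: scalar_fixes_lines def_A.
have actE A L : A \in SL2 F ->
    actperm (PG1_action F %% 'Z(SL2 F)) (coset 'Z(SL2 F) A) L = PG1_act L A.
  move=> SA; have nA: A \in ('N('Z(SL2 F)))%g.
    exact: (subsetP (normal_norm (center_normal (SL2_group F))) A SA).
  by rewrite actpermE /= modactE ?in_setT.
apply: (iffP morphimP) => [[_ _ /morphimP[A nA SA ->] ->]|[A SA hE]].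
  by exists A => // L; apply: actE.
exists (coset 'Z(SL2 F) A); try by apply: mem_quotient; rewrite ?in_setT.
by apply/permP=> L; rewrite actE // hE.
Qed.

Lemma PSL2_two_transitive (L M L' M' : PG1 F) : L != M -> L' != M' ->
  exists2 h : {perm PG1 F}, h \in PSL2_perm F & h L = L' /\ h M = M'.
Proof.
move=> LM LM'; have [A SA [AL AM]] := SL2_two_transitive LM LM'.
exists (actperm (PG1_action F) A); last by rewrite !actpermE.
by apply/PSL2_permP; exists A => // N; rewrite actpermE.
Qed.

(** In the basis given by the two fixed lines a representative in SL(2, F) is
    diagonal with eigenvalues a and b such that ab = 1; when such a and b always
    coincide it is scalar. *)
Lemma PSL2_fix2 (h : {perm PG1 F}) L M :
    (forall a b : F, a * b = 1 -> a = b) ->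
  h \in PSL2_perm F -> L != M -> h L = L -> h M = M -> h = 1%g.
Proof.
move=> inv_id /PSL2_permP[A SA hE]; rewrite !hE.
have [v v0 Lv] := lineP L; have [w w0 Mw] := lineP M.
rewrite -val_eqE /= Lv Mw => LM.
move=> /(congr1 val); rewrite (span_image A Lv) Lv => fixL.
move=> /(congr1 val); rewrite (span_image A Mw) Mw => fixM.
have [a vA]: exists a, v *m GLval A = a *: v.
  by apply/spanP; rewrite -fixL span_id.
have [b wA]: exists b, w *m GLval A = b *: w.
  by apply/spanP; rewrite -fixM span_id.
have dV := basis_mx_unit v0 w0 LM; set V := basis_mx v w in dV.
have VU : V \in unitmx by rewrite unitmxE unitfE.
have VA: V *m GLval A = basis_mx (a *: v) (b *: w).
  by rewrite basis_mxM vA wA.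
have ab: a = b.
  apply: inv_id; apply: (mulIf dV); rewrite -basis_mxZ -VA det_mulmx mul1r.
  by move: SA; rewrite inE => /eqP->; rewrite mulr1.
have def_A: GLval A = a%:M.
  rewrite -[LHS](mulKmx VU) VA -ab.
  rewrite (_ : basis_mx _ _ = a *: V).
    by rewrite -scalemxAr mulVmx // scalemx1.
  by apply/row_matrixP=> i; rewrite linearZ /= /V !rowK; case: ifP.
by apply/permP=> N; rewrite hE perm1; apply: scalar_fixes_lines def_A.
Qed.

(** Homogeneous coordinates: (1, a) for the affine point a, and (0, 1) for the
    point at infinity None. *)
Definition PG1_vector (x : option F) : 'rV[F]_2 :=
  \row_j (if x is Some a then if j == 0 then 1 else a
          else if j == 0 then 0 else 1).

Lemma PG1_vector_neq0 x : PG1_vector x != 0.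
Proof.
apply/eqP; case: x => [a|] /rowP; [move/(_ 0) | move/(_ 1)];
  rewrite !mxE /= => /eqP; exact/negP/oner_neq0.
Qed.

Definition PG1_point (x : option F) : PG1 F :=
  exist _ (span (PG1_vector x)) (span_is_line (PG1_vector_neq0 x)).

Lemma PG1_point_inj : injective PG1_point.
Proof.
move=> x y /(congr1 val) /= eq_xy.
have: PG1_vector x \in span (PG1_vector y) by rewrite -eq_xy span_id.
case/spanP=> c /rowP eqc; have := eqc 0; have := eqc 1.
rewrite !mxE /=; case: x y {eq_xy eqc} => [a|] [b|] //=.
- by rewrite mulr1 => ac c1; rewrite ac -c1 mul1r.
- by rewrite mulr0 => _ /eqP; rewrite oner_eq0.
- by rewrite mulr1 => cb c0; move/eqP: cb; rewrite -c0 mul0r oner_eq0.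
Qed.

Lemma card_PG1 : #|PG1 F| = #|F|.+1.
Proof.
rewrite -card_option -(card_codom PG1_point_inj); apply/esym/eq_card=> L.
rewrite [RHS]inE; apply/codomP; have [v v0 Lv] := lineP L.
suff [x [c c0 def_v]]: exists x, exists2 c, c != 0 & v = c *: PG1_vector x.
  by exists x; apply: val_inj; rewrite Lv def_v spanZ.
have [v00|v00] := eqVneq (v 0 0) 0.
  have def_v: v = v 0 1 *: PG1_vector None.
    apply/rowP=> j; rewrite !mxE; have [->|j0] := eqVneq j 0.
      by rewrite v00 mulr0.
    by rewrite mulr1; congr (v _ _); apply: val_inj; case: j j0 => [[|[|]]].
  exists None, (v 0 1) => //.
  by apply: contraNneq v0 => v01; rewrite def_v v01 scale0r.
exists (Some (v 0 1 / v 0 0)), (v 0 0) => //.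
apply/rowP=> j; rewrite !mxE; have [->|j0] := eqVneq j 0.
  by rewrite mulr1.
rewrite mulrC divfK //.
by congr (v _ _); apply: val_inj; case: j j0 => [[|[|]]].
Qed.

End Groups.

(** * The two groups on four points *)

Lemma F3_self_inverse (a b : 'F_3) : (a * b = 1 -> a = b)%R.
Proof.
by case: a b => [[|[|[|//]]] ?] [[|[|[|//]]] ?] // _; apply: val_inj.
Qed.

Lemma PSL2_3_ast :
  exists P : 'I_6 -> {set 3.-tuple (PG1 'F_3)}, induced_ast (PSL2_perm 'F_3) P.
Proof.
apply: sharply_two_transitive_ast.
- exact: PSL2_two_transitive.
- by move=> h L M; apply: PSL2_fix2; apply: F3_self_inverse.
by rewrite card_PG1 card_Fp.
Qed.

Lemma AGL1_4_ast (K : finFieldType) : #|K| = 4 ->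
  exists A : 'I_6 -> {set 3.-tuple K}, induced_ast (AGL1_group K) A.
Proof.
apply: sharply_two_transitive_ast; first exact: AGL1_two_transitive.
exact: AGL1_fix2.
Qed.

(** The scheme of PSL(2, 3), carried over to 'I_4, has the listed nontrivial
    relations in one of the two orders; exchanging the last two indices corrects
    the order when necessary. *)
Lemma listed_ast : exists R : 'I_6 -> {set 3.-tuple 'I_4},
  [/\ is_ast R, R (inord 4) = rel4 & R (inord 5) = rel5].
Proof.
have [P [_ _ astP _]] := PSL2_3_ast.
have PG4: #|PG1 'F_3| = 4 by rewrite card_PG1 card_Fp.
have [f [g fK gK]] := card4_enum PG4.
have astS := image_rel_ast gK fK astP; set S := fun i => _ in astS.
case: (ast4_unique astS) => -[S4 S5]; first by exists S.
exists (S \o tperm (inord 4) (inord 5)); rewrite /= tpermL tpermR; split=> //.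
apply: reindex_ast astS => i i4; rewrite tpermD //.
  by apply: contraTneq i4 => <-; rewrite inordK.
by apply: contraTneq i4 => <-; rewrite inordK.
Qed.

Theorem mainTheorem4 :
  exists R : 'I_6 -> {set 3.-tuple 'I_4},
    [/\ is_ast R /\ (forall S : 'I_6 -> {set 3.-tuple 'I_4},
          is_ast S -> ast_isomorphic R S),
        R (inord 4) = rel4 /\ R (inord 5) = rel5,
        exists2 P : 'I_6 -> {set 3.-tuple (PG1 'F_3)},
          induced_ast (PSL2_perm 'F_3) P & ast_isomorphic R P
      & forall GF4 : finFieldType, #|GF4| = 4 ->
          exists2 A : 'I_6 -> {set 3.-tuple GF4},
            induced_ast (AGL1_group GF4) A & ast_isomorphic R A].
Proof.
have [R [astR R4 R5]] := listed_ast; exists R.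
split=> //.
- by split=> // S astS; apply: ast4_isomorphic; rewrite ?card_ord.
- have [P indP] := PSL2_3_ast; exists P => //; case: indP => _ _ astP _.
  by apply: ast4_isomorphic; rewrite ?card_PG1 ?card_Fp.
move=> K K4; have [A indA] := AGL1_4_ast K4; exists A => //.
by case: indA => _ _ astA _; apply: ast4_isomorphic.
Qed.
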